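(* Let $\Bbbk$ be a field and let $\sim$ be a word relation. Then $\widehat{\mathbf{K}}_{\mathsf P}^{(\sim)}$ is a linearly compact Hopf subalgebra of $(\widehat{\mathbf{W}}_{\mathsf P},\nabla_{\mathrm{sh}},\iota_{\mathrm{sh}},\Delta_\odot,\epsilon_\odot)$ if and only if $\sim$ is $\mathsf P$-algebraic. If moreover $\sim$ is homogeneous, then $\mathbf{K}_{\mathsf P}^{(\sim)}$ is a graded Hopf subalgebra of $(\mathbf{W}_{\mathsf P},\nabla_{\mathrm{sh}},\iota_{\mathrm{sh}},\Delta_\odot,\epsilon_\odot)$ if and only if $\sim$ is $\mathsf P$-algebraic.
   Context: Words. $\mathbb N=\{0,1,2,\dots\}$ and $[n]=\{1,\dots,n\}$. A word is a finite sequence of positive integers; $\emptyset$ is the empty word, $\ell(w)$ is the length of $w$, $\max(w)$ its largest letter, $\max(\emptyset)=0$. $w\uparrow m$ and $w\downarrow m$ are formed by adding $m$ to, respectively subtracting $m$ from, every letter of $w$. For a set $S$, $w\cap S$ is the subword of $w$ formed by omitting all letters not in $S$. For words $u,v$ of lengths $m,n$, the shuffle product $u\sqcup\!\sqcup v$ is the sum, over all $I\subset[m+n]$ with $|I|=m$, of the unique $(m+n)$-letter word whose restriction to positions in $I$ is $u$ and to positions in $[m+n]\setminus I$ is $v$. If the set of letters of $w$ has $m$ elements and $\phi$ is the order-preserving bijection from this set to $[m]$, then $\mathrm{fl}(w)=\phi(w_1)\phi(w_2)\cdots$. A packed word is a word with $w=\mathrm{fl}(w)$; $\mathbb W_{\mathsf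 P}$ is the set of packed words. Word relations. A word relation is an equivalence relation $\sim$ on words such that $v\sim w$ only if $v$ and $w$ have the same set of letters (multiplicities may differ). It is homogeneous if $v\sim w$ implies $\ell(v)=\ell(w)$. For packed words $u,v$, a packed word $w$ is a $(u,v)$-destandardization if there are (not necessarily packed) words $\tilde u,\tilde v$ with $w=\tilde u\tilde v$ (concatenation), $u=\mathrm{fl}(\tilde u)$, $v=\mathrm{fl}(\tilde v)$. A word relation $\sim$ is $\mathsf P$-algebraic (over $\Bbbk$) if for all $v,w\in\mathbb W_{\mathsf P}$: (a) if $v',w'\in\mathbb W_{\mathsf P}$, $v\sim v'$ and $w\sim w'$, then in any $\sim$-equivalence class the numbers of $(v,w)$- and $(v',w')$-destandardizations are equal if $\operatorname{char}\Bbbk=0$, or congruent modulo $p$ if $\operatorname{char}\Bbbk=p>0$; (b) if $v\sim w$ and $I=\{m+1,m+2,\dots,n\}$ with $m,n\in\mathbb N$, then $(v\cap I)\downarrow m\sim(w\cap I)\downarrow m$. Linearly compact spaces. A linearly compact $\Bbbk$-vector space is a topological vector space of the form $V=\prod_{i\in I}\Bbbk v_i$ with the product topology, each line $\Bbbk v_i$ being discrete; $\{v_i\}$ is called a pseudobasis (each $v\in V$ is uniquely a possibly infinite sum $\sum_i c_iv_i$). Morphisms are continuous linear maps. If $V,W$ have pseudobases $\{v_i\},\{w_j\}$, the completed tensor product $V\hat\otimes W$ is the linearly compact space with pseudobasis $\{v_i\otimes w_j\}$ (intrinsically $(V^\vee\otimes W^\vee)^*$ with $\vee$ the continuous dual).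 With unit object $\Bbbk$ and braiding $x\otimes y\mapsto y\otimes x$ this is a symmetric monoidal category; linearly compact bialgebras and Hopf algebras are the bimonoids and Hopf monoids in it. A linearly compact Hopf subalgebra is a linearly compact subspace to which all structure maps (product, unit, coproduct, counit, antipode) restrict, using $\hat\otimes$ of the subspace. The Hopf algebras. $\mathbf W_{\mathsf P}=\Bbbk\mathbb W_{\mathsf P}$ (basis $\mathbb W_{\mathsf P}$, graded by word length) is a graded Hopf algebra with unit element $\emptyset$, counit $\epsilon_\odot(\emptyset)=1$, $\epsilon_\odot(w)=0$ for $w\ne\emptyset$, product $\nabla_{\mathrm{sh}}(u\otimes v)=u\sqcup\!\sqcup(v\uparrow\max(u))$ and coproduct $\Delta_\odot(w)=\sum_{i=0}^n\mathrm{fl}(w_1\cdots w_i)\otimes\mathrm{fl}(w_{i+1}\cdots w_n)$, $n=\ell(w)$. $\widehat{\mathbf W}_{\mathsf P}$ is the linearly compact space with pseudobasis $\mathbb W_{\mathsf P}$; the structure maps extend continuously, making it a linearly compact Hopf algebra. The subspaces. For each $\sim$-equivalence class $E$ contained in $\mathbb W_{\mathsf P}$ let $\kappa_E=\sum_{w\in E}w\in\widehat{\mathbf W}_{\mathsf P}$ (possibly an infinite sum). $\mathbf K_{\mathsf P}^{(\sim)}$ is the $\Bbbk$-linear span of all $\kappa_E$, and $\widehat{\mathbf K}_{\mathsf P}^{(\sim)}\subset\widehat{\mathbf W}_{\mathsf P}$ is the space of all possibly infinite linear combinations of the $\kappa_E$ (the linearly compact space with pseudobasis $\{\kappa_E\}$).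 If $\sim$ is homogeneous, then $\mathbf K_{\mathsf P}^{(\sim)}\subset\mathbf W_{\mathsf P}$. *)

(* Defs.v *)
From HB Require Import structures.
From mathcomp Require Import all_boot all_order all_algebra finmap.
From mathcomp Require Import all_classical topology.

Set Implicit Arguments.
Unset Strict Implicit.
Unset Printing Implicit Defensive.
Import GRing.Theory.
Local Open Scope classical_set_scope.
Local Open Scope ring_scope.

(* Letters are the positive integers; they are stored in [nat], so that the
   words are the [w : seq nat] with [is_word w]. *)
Definition is_word (w : seq nat) : bool := 0%N \notin w.

Definition wmax (w : seq nat) : nat := (\max_(a <- w) a)%N.
Definition wup (m : nat) (w : seq nat) : seq nat := [seq (a + m)%N | a <- w].
Definition wdown (m : nat) (w : seq nat) : seq nat := [seq (a - m)%N | a <- w].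

(* w \cap {m+1, ..., n} *)
Definition wrestrict (m n : nat) (w : seq nat) : seq nat :=
  [seq a <- w | m < a <= n]%N.

(* The order-preserving bijection from the letters of w to [m] sends a to the
   number of distinct letters b <= a of w. *)
Definition fl (w : seq nat) : seq nat :=
  [seq count (fun b => b <= a)%N (undup w) | a <- w].

Definition is_packed (w : seq nat) : bool := fl w == w.
Record packed := Packed { word_of :> seq nat; _ : is_packed word_of }.
HB.instance Definition _ := [isSub for word_of].
HB.instance Definition _ := [Choice of packed by <:].
Definition packed0 : packed := @Packed [::] isT.

(* The subword of w formed by the letters at the positions in A. *)
Definition subword (w : seq nat) (A : {set 'I_(size w)}) : seq nat :=
  [seq tnth (in_tuple w) i | i <- enum A].

(* The coefficient of w in the shuffle product of u and v: the number of sets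
   I of positions for which w is the word that restricts to u on I and to v on
   the complement of I. *)
Definition shuffle_coef (u v w : seq nat) : nat :=
  #|[pred A : {set 'I_(size w)} | (subword A == u) && (subword (~: A) == v)]|.

Definition destandardization (u v w : seq nat) : Prop :=
  is_packed w /\
  exists u' v', [/\ is_word u', is_word v', w = u' ++ v', fl u' = u & fl v' = v].

Definition word_relation (sim : seq nat -> seq nat -> Prop) : Prop :=
  [/\ forall w, is_word w -> sim w w,
      forall v w, sim v w -> sim w v,
      forall u v w, sim u v -> sim v w -> sim u w &
      forall v w, sim v w -> [/\ is_word v, is_word w & v =i w]].

Definition homogeneous (sim : seq nat -> seq nat -> Prop) : Prop :=
  forall v w, sim v w -> size v = size w.

(* The number of (u,v)-destandardizations in the class of x; the set is finite,
   as its elements have length [size u + size v] and letters at most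
   [wmax u + wmax v]. *)
Definition ndestd (sim : seq nat -> seq nat -> Prop) (u v x : seq nat) : nat :=
  #|` fset_set [set w | sim x w /\ destandardization u v w] |%fset.

Definition P_algebraic (k : fieldType) (sim : seq nat -> seq nat -> Prop) :
    Prop :=
  (forall v w v' w' : seq nat,
     is_packed v -> is_packed w -> is_packed v' -> is_packed w' ->
     sim v v' -> sim w w' -> forall x, is_word x ->
     ([pchar k] =i pred0 -> ndestd sim v w x = ndestd sim v' w' x) /\
     (forall p, p \in [pchar k] ->
        ndestd sim v w x = ndestd sim v' w' x %[mod p])) /\
  (forall v w : seq nat, is_packed v -> is_packed w -> sim v w ->
     forall m n : nat,
     sim (wdown m (wrestrict m n v)) (wdown m (wrestrict m n w))).

(* The linearly compact space with pseudobasis indexed by I is the space of all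
   functions [I -> k], with the product of the discrete topologies: f stands
   for the possibly infinite sum of the f i v_i. The completed tensor product
   of [I -> k] and [J -> k] is then [I * J -> k]. The free vector space on I is
   the subspace [finsupp]. *)
Section LinearlyCompact.
Variable k : fieldType.

Definition lc_continuous (I J : Type) (F : (I -> k) -> (J -> k)) : Prop :=
  continuous (F : {ptws I -> discrete_topology k} ->
                  {ptws J -> discrete_topology k}).

Definition lc_open (I : Type) (U : set (I -> k)) : Prop :=
  open (U : set {ptws I -> discrete_topology k}).

Definition linear_on (I J : Type) (D : set (I -> k))
    (F : (I -> k) -> (J -> k)) : Prop :=
  forall (a : k) f g, D f -> D g ->
    F (fun i => a * f i + g i) = (fun j => a * F f j + F g j).

Definition lc_morphism (I J : Type) (F : (I -> k) -> (J -> k)) : Prop :=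
  linear_on setT F /\ lc_continuous F.

Definition delta (I : choiceType) (i : I) : I -> k := fun j => (j == i)%:R.

(* The possibly infinite sum of the c_j b_j over j in A, for a family b whose
   members b_j vanish at each given i for all but finitely many j.
   For A = setT, it is the continuous linear map sending each v_j to b_j. *)
Definition lc_sum (I : Type) (J : choiceType) (A : set J) (b : J -> I -> k)
    (c : J -> k) : I -> k :=
  fun i => \sum_(j \in A) (c j * b j i).

Definition lc_extend (I : Type) (J : choiceType) (b : J -> I -> k) :
    (J -> k) -> (I -> k) := lc_sum setT b.

Definition tensor (I J : Type) (f : I -> k) (g : J -> k) : I * J -> k :=
  fun p => f p.1 * g p.2.

(* The (completed) tensor product of two (continuous) linear maps. *)
Definition tensor_map (I J : choiceType) (I' J' : Type)
    (F : (I -> k) -> (I' -> k)) (G : (J -> k) -> (J' -> k)) :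
    (I * J -> k) -> (I' * J' -> k) :=
  lc_extend (fun p : I * J => tensor (F (delta p.1)) (G (delta p.2))).

(* [phi] is an isomorphism of topological vector spaces from [J -> k] onto L
   with the subspace topology, i.e. the [phi (delta j)] are a pseudobasis of
   L. *)
Definition lc_parametrization (I J : Type) (phi : (J -> k) -> (I -> k))
    (L : set (I -> k)) : Prop :=
  [/\ lc_morphism phi, injective phi, range phi = L &
      forall U, lc_open U -> exists2 V, lc_open V & phi @` U = V `&` L].

Definition finsupp (I : Type) : set (I -> k) :=
  [set f | finite_set [set i | f i != 0]].

Definition span (I : Type) (B : set (I -> k)) : set (I -> k) :=
  [set f | exists (n : nat) (b : 'I_n -> I -> k) (c : 'I_n -> k),
     (forall t, B (b t)) /\ f = (fun i => \sum_(t < n) c t * b t i)].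

Record hopf_maps (I : Type) := HopfMaps {
  hmul : (I * I -> k) -> (I -> k);
  hunit : k -> (I -> k);
  hcomul : (I -> k) -> (I * I -> k);
  hcounit : (I -> k) -> k }.

Definition antipode_on (I : choiceType) (H : hopf_maps I) (D : set (I -> k))
    (S : (I -> k) -> (I -> k)) : Prop :=
  forall f, D f ->
    hmul H (tensor_map S id (hcomul H f)) = hunit H (hcounit H f) /\
    hmul H (tensor_map id S (hcomul H f)) = hunit H (hcounit H f).

(* LL is the tensor square of L; the counit, with values in k, always
   restricts. *)
Definition maps_restrict (I : Type) (H : hopf_maps I)
    (S : (I -> k) -> (I -> k)) (L : set (I -> k)) (LL : set (I * I -> k)) :
    Prop :=
  [/\ forall x, LL x -> L (hmul H x),
      forall c, L (hunit H c),
      forall f, L f -> LL (hcomul H f) &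
      forall f, L f -> L (S f)].

(* Antipodes are unique, hence S is the antipode of the ambient Hopf algebra.
   The image of [tensor_map phi phi] is the completed tensor square of L inside
   [I * I -> k]. *)
Definition lc_hopf_subalgebra (I : choiceType) (H : hopf_maps I)
    (L : set (I -> k)) : Prop :=
  exists (J : choiceType) (phi : (J -> k) -> (I -> k))
         (S : (I -> k) -> (I -> k)),
    [/\ lc_parametrization phi L,
        lc_morphism S, antipode_on H setT S &
        maps_restrict H S L (range (tensor_map phi phi))].

Definition graded_subspace (I : Type) (deg : I -> nat) (L : set (I -> k)) :
    Prop :=
  [/\ L `<=` @finsupp I, L (fun _ => 0),
      forall (a : k) f g, L f -> L g -> L (fun i => a * f i + g i) &
      forall (n : nat) f, L f -> L (fun i => if deg i == n then f i else 0)].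

(* For the free vector space on I, graded by deg. *)
Definition graded_hopf_subalgebra (I : choiceType) (deg : I -> nat)
    (H : hopf_maps I) (L : set (I -> k)) : Prop :=
  exists S : (I -> k) -> (I -> k),
    [/\ graded_subspace deg L,
        linear_on (@finsupp I) S /\ (forall f, finsupp f -> finsupp (S f)),
        antipode_on H (@finsupp I) S &
        maps_restrict H S L
          (span [set x | exists f g, [/\ L f, L g & x = tensor f g]])].

Definition mul_sh (p : packed * packed) : packed -> k :=
  fun w => (shuffle_coef p.1 (wup (wmax p.1) p.2) w)%:R.

Definition comul_odot (w : packed) : packed * packed -> k :=
  fun p => \sum_(i < (size w).+1)
    ((fl (take i w) == p.1) && (fl (drop i w) == p.2))%:R.

(* On [finsupp], these are the structure maps of W_P; on all functions, those
   of its completion. *)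
Definition W_P : hopf_maps packed :=
  {| hmul := lc_extend mul_sh;
     hunit := fun c w => c * delta packed0 w;
     hcomul := lc_extend comul_odot;
     hcounit := fun f => f packed0 |}.

Definition wdeg (w : packed) : nat := size w.

Variable sim : seq nat -> seq nat -> Prop.

Definition packed_classes : set (set packed) :=
  [set E | exists w : packed, E = [set v : packed | sim w v]].

Definition kappa (E : set packed) : packed -> k := fun w => (w \in E)%:R.

Definition K_P : set (packed -> k) := span (kappa @` packed_classes).

Definition K_P_hat : set (packed -> k) :=
  range (lc_sum packed_classes kappa).

End LinearlyCompact.

Arguments P_algebraic k sim : clear implicits.
Arguments W_P k : clear implicits.
Arguments K_P k sim : clear implicits.
Arguments K_P_hat k sim : clear implicits.

(* Main.v *)
From mathcomp Require Import all_boot all_algebra finmap zify.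
From mathcomp Require Import all_classical topology.
Require Import Defs.

Set Implicit Arguments.
Unset Strict Implicit.
Unset Printing Implicit Defensive.
Import GRing.Theory.
Local Open Scope classical_set_scope.
Local Open Scope ring_scope.

(** An element of the completion is a function on packed words, so everything
    can be computed with values of functions. Write M for the largest letter
    of the packed word w, and w(i, j] for the packed word obtained from the
    letters of w in {i+1, ..., j} by subtracting i.

    - The letters of the two factors of a shifted shuffle are disjoint
      intervals, so the value of a product at w only sees the pairs (w(0,
      m], w(m, M]) with m <= M: it is the sum over m of the values at these
      pairs ([hmulE]).
    - The value of the coproduct of f at (a, b) is the sum of f over the (a,
      b)-destandardizations, which are finitely many ([hcomulE],
      [destandardizationP]).
    - The possibly infinite combinations of the kappa_E are the functions
      that are constant on the classes ([K_P_hatE]), and their completed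
      tensor square consists of the functions on pairs constant on products
      of classes ([range_tensor_of_reps]). For a homogeneous relation the
      classes are finite, and the finite combinations are the invariant
      functions with finite support.

    Hence the coproduct of kappa_E has at (a, b) the number of (a,
    b)-destandardizations in E, taken in the field, so that stability under
    the coproduct is the first half of P-algebraicity. Similarly the product
    of two kappa's is 1 at w exactly when w(0, m] and w(m, M] lie in the two
    classes, for m the largest letter of the words of the first class
    ([hmul_kappa]); so stability under the product says that these two kinds
    of restriction respect the relation. Any restriction is a restriction of
    the first kind followed by one of the second, which gives the second
    half.

    It remains to produce an antipode and to see that it preserves invariant
    functions. The antipode axiom determines a left inverse S of the
    identity for convolution by recursion on M: for M > 0, S f (w) is minus
    the sum over m < M of the value at w(0, m] of S applied to the function
    u |-> (coproduct of f)(u, w(m, M]). Induction on M, with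
    coassociativity, shows that S is also a right inverse
    ([antipode_right]), and the recursion only uses operations that preserve
    invariance ([invariant_antipode]). *)

(** * Linearly compact spaces *)

Section Topology.
Variable k : fieldType.
Implicit Types I J : choiceType.

Lemma ptws_nbhsP I (f : {ptws I -> discrete_topology k}) (U : set (I -> k)) :
  nbhs f U <->
  exists D : seq I, forall g : I -> k, {in D, g =1 f} -> U g.
Proof.
split.
  case=> P [[Q QfinP <-] [V JV Vf]] sub.
  have [L Lsub VL] := QfinP _ JV.
  suff [D DP] : exists D : seq I, forall g : I -> k, {in D, g =1 f} -> V g.
    by exists D => g /DP Vg; apply: sub; exists V.
  have {}Lsub : forall M, M \in L -> exists i, forall g : I -> k, g i = f i ->
    M g.
    move=> M ML; have /set_mem [i _ [B oB BM]] := Lsub _ ML.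
    exists i => g gi; have : M f by move: Vf; rewrite -VL => /(_ _ ML).
    by rewrite -BM /preimage /= gi.
  have [ix ixP] : exists ix : set (I -> k) -> seq I,
      forall M, M \in L -> forall g : I -> k, {in ix M, g =1 f} -> M g.
    have : forall M : set (I -> k), exists D : seq I, M \in L ->
        forall g : I -> k, {in D, g =1 f} -> M g.
      move=> M; case: (boolP (M \in L)) => [/Lsub [i iP]|_];
        last by exists [::].
      by exists [:: i] => _ g gf; apply: iP; apply: gf; rewrite inE.
    by move=> /choice [ix ixP]; exists ix.
  exists (flatten [seq ix M | M <- L]) => g gf; rewrite -VL => M ML.
  apply: (ixP M ML) => i iM; apply: gf; apply/flattenP; exists (ix M) => //.
  exact: map_f.
case=> D DU.
have : nbhs f [set g : {ptws I -> discrete_topology k} | {in D, g =1 f}].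
  elim: {DU} D => [|i D IH]; first by apply: filterS filterT => g _ i.
  have fi : nbhs f [set g : {ptws I -> discrete_topology k} | g i = f i].
    by apply: (@proj_continuous I (fun=> discrete_topology k) i f [set f i]);
      exact: discrete_set1.
  apply: filterS (filterI fi IH) => g [gi gD] j.
  by rewrite inE => /predU1P[->|/gD].
by apply: filterS => g /DU.
Qed.

Lemma fsum_seq (T : choiceType) (r : seq T) (f : T -> k) : uniq r ->
  (forall i, i \notin r -> f i = 0) ->
  \sum_(i \in setT) f i = \sum_(i <- r) f i.
Proof.
move=> ur fr; rewrite (fsbigE r) //=; first by apply: eq_bigl => i;
  rewrite in_setT.
by move=> i _; exact: fr.
Qed.

(** Continuity for products of discrete spaces is finite dependence: a
    coordinate of the image is determined by finitely many coordinates of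
    the argument. *)
Lemma finitary_continuous I J (F : (I -> k) -> (J -> k)) :
  (forall j, exists D : seq I, forall f g, {in D, f =1 g} -> F f j = F g j) ->
  lc_continuous F.
Proof.
move=> /choice [D DP] f U /ptws_nbhsP [E EU]; apply/ptws_nbhsP.
exists (flatten [seq D j | j <- E]) => g gf; apply: EU => j jE.
by apply: DP => i iD; apply: gf; apply/flattenP; exists (D j); rewrite ?map_f.
Qed.

Lemma lc_morphism0 I J (F : (I -> k) -> (J -> k)) : lc_morphism F ->
  forall j, F (fun=> 0) j = 0.
Proof.
case=> lin _ j; have := lin (-1) (fun=> 0) (fun=> 0) Logic.I Logic.I.
under eq_fun do rewrite mulr0 addr0.
by move=> {1}->; rewrite mulN1r addNr.
Qed.

Lemma lc_morphism_lin I J (F : (I -> k) -> (J -> k)) : lc_morphism F ->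
  forall a f j, F (fun i => a * f i) j = a * F f j.
Proof.
move=> mF a f j; have F0 := lc_morphism0 mF j; case: mF => lin _.
have /(congr1 (fun h => h j)) := lin a f (fun=> 0) Logic.I Logic.I.
by under eq_fun do rewrite addr0; move=> ->; rewrite F0 addr0.
Qed.

(** The kernel of the continuous functional [fun f => F f j] is open, hence it
    contains all functions vanishing on some finite set D of indices; any f
    differs from its truncation to D by such a function. *)
Lemma lc_morphism_finitary I J (F : (I -> k) -> (J -> k)) : lc_morphism F ->
  forall j, exists D : seq I, [/\ uniq D,
    (forall i, i \notin D -> F (delta k i) j = 0) &
    forall f, F f j = \sum_(i <- D) f i * F (delta k i) j].
Proof.
move=> mF j; have F0 : F (fun=> 0) = fun=> 0 by apply/funext;
  exact: lc_morphism0.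
case: mF => lin cF.
have [D DP] : exists D : seq I, forall g : I -> k, {in D, g =1 fun=> 0} ->
    F g j = 0.
  have /ptws_nbhsP [D DP] : nbhs ((fun=> 0) : {ptws I -> discrete_topology k})
      [set g | F g j = 0].
    apply: (cF (fun=> 0) [set h | h j = 0]); rewrite F0.
    by apply/ptws_nbhsP; exists [:: j] => g gj; apply: gj; rewrite inE.
  by exists D.
have Fsum : forall (r : seq I) f,
    F (fun x => \sum_(i <- r) f i * delta k i x) j =
    \sum_(i <- r) f i * F (delta k i) j.
  move=> r f; elim: r => [|i r IH].
    rewrite big_nil; under eq_fun do rewrite big_nil; by rewrite F0.
  rewrite big_cons -IH.
  under eq_fun do rewrite big_cons.
  by rewrite lin.
exists (undup D); split => [||f]; first exact: undup_uniq.
  move=> i iD; apply: DP => x xD; rewrite /delta; case: eqP => // xi.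
  by rewrite -mem_undup xi (negPf iD) in xD.
rewrite -Fsum; apply/eqP; rewrite -subr_eq0 addrC -mulN1r; apply/eqP.
have /(congr1 (fun h => h j)) /= <- := lin (-1)
  (fun x => \sum_(i <- undup D) f i * delta k i x) f Logic.I Logic.I.
apply: DP => x xD; rewrite (bigD1_seq x) ?mem_undup ?undup_uniq //=.
rewrite /delta eqxx big1 => [|i /negPf ix]; last by rewrite eq_sym ix mulr0.
by rewrite mulr1 addr0 mulN1r addNr.
Qed.

(** The matrix definition of the tensor product of two maps amounts to applying
    G in the second variable, then F in the first. *)
Lemma tensor_mapE I J (I' J' : choiceType) (F : (I -> k) -> (I' -> k))
    (G : (J -> k) -> (J' -> k)) (y : I * J -> k) a b :
  lc_morphism F -> lc_morphism G ->
  tensor_map F G y (a, b) = F (fun u => G (fun v => y (u, v)) b) a.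
Proof.
move=> /lc_morphism_finitary /(_ a) [D [uD D0 FD]].
move=> /lc_morphism_finitary /(_ b) [E [uE E0 GE]].
rewrite /tensor_map /lc_extend /lc_sum.
rewrite (@fsum_seq _ [seq (u, v) | u <- D, v <- E]); first last.
- case=> u v; rewrite /tensor /=.
  have [uD'|/D0 ->] := boolP (u \in D); last by rewrite mul0r mulr0.
  have [vE|/E0 ->] := boolP (v \in E); last by rewrite !mulr0.
  by rewrite allpairs_f.
- by rewrite allpairs_uniq // => -[? ?] [? ?].
rewrite big_allpairs FD; apply: eq_bigr => u _.
rewrite GE mulr_suml; apply: eq_bigr => v _.
by rewrite /tensor /= mulrA mulrAC.
Qed.

End Topology.

(** * Packed words and their pieces *)

Section Words.
Local Open Scope nat_scope.
Implicit Types (u v w : seq nat) (a b i j m n : nat).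

Lemma fl_map w (h : nat -> nat) :
  {in w &, {mono h : a b / a <= b}} -> fl (map h w) = fl w.
Proof.
move=> hmono; have hinj : {in w &, injective h}.
  by move=> a b aw bw hab; apply/eqP; rewrite eqn_leq -hmono // -[X in _ &&
    X]hmono // hab leqnn.
have /permP undup_h : perm_eq (undup (map h w)) (map h (undup w)).
  apply: uniq_perm; rewrite ?undup_uniq ?map_inj_in_uniq ?undup_uniq //.
    by move=> a b; rewrite !mem_undup; exact: hinj.
  by move=> a; rewrite mem_undup; apply: eq_mem_map => b; rewrite mem_undup.
rewrite /fl -map_comp; apply/eq_in_map => a aw /=; rewrite undup_h.
rewrite count_map; apply: eq_in_count => b; rewrite mem_undup => bw.
by rewrite /= hmono.
Qed.

Lemma fl_mono w :
  {in w &, {mono (fun a => count (leq^~ a) (undup w)) : a b / a <= b}}.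
Proof.
move=> a b aw bw /=; have [ab|ba] := leqP a b.
  by apply: sub_count => c /= ca; apply: leq_trans ab.
apply/negbTE; rewrite -ltnNge.
have -> : count (leq^~ a) (undup w) = count (leq^~ b) (undup w)
    + count (fun c => b < c <= a) (undup w).
  rewrite -count_predUI -[LHS]addn0; congr (_ + _).
    by apply: eq_count => c /=; lia.
  by symmetry; apply/eqP; rewrite -leqn0 leqNgt -has_count;
    apply/hasPn => c _ /=; lia.
rewrite -[X in X < _]addn0 ltn_add2l -has_count.
by apply/hasP; exists a; rewrite ?mem_undup // ba leqnn.
Qed.

Lemma fl_fl w : fl (fl w) = fl w.
Proof. exact: (fl_map (@fl_mono w)). Qed.

Lemma fl_map_sub u w : {subset u <= w} ->
  fl [seq count (leq^~ a) (undup w) | a <- u] = fl u.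
Proof. by move=> uw; apply: fl_map => a b /uw aw /uw bw; apply: fl_mono. Qed.

Lemma fl_take i w : fl (take i (fl w)) = fl (take i w).
Proof. by rewrite {2}/fl -map_take; apply: fl_map_sub => a /mem_take. Qed.

Lemma fl_drop i w : fl (drop i (fl w)) = fl (drop i w).
Proof. by rewrite {2}/fl -map_drop; apply: fl_map_sub => a /mem_drop. Qed.

Lemma size_fl w : size (fl w) = size w.
Proof. exact: size_map. Qed.

Lemma leq_wmax w a : a \in w -> a <= wmax w.
Proof. by move=> aw; rewrite /wmax; apply: (@leq_bigmax_seq _ w xpredT id). Qed.

Lemma wmax_leq w m : {in w, forall a, a <= m} -> wmax w <= m.
Proof. by move=> h; apply/bigmax_leqP_seq => a /h. Qed.

Lemma wmax_eq_mem u w : u =i w -> wmax u = wmax w.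
Proof.
move=> uw; apply/eqP; rewrite eqn_leq; apply/andP; split; apply: wmax_leq => a.
  by rewrite uw; exact: leq_wmax.
by rewrite -uw; exact: leq_wmax.
Qed.

Lemma wmax_interval w m : (forall a, (a \in w) = (0 < a <= m)) -> wmax w = m.
Proof.
move=> wP; apply/eqP; rewrite eqn_leq wmax_leq => [/=|a];
  last by rewrite wP => /andP[].
by case: m wP => // m wP; apply: leq_wmax; rewrite wP leqnn.
Qed.

Lemma interval_packed w m : (forall a, (a \in w) = (0 < a <= m)) -> is_packed w.
Proof.
move=> wP; apply/eqP; rewrite /fl -[RHS]map_id; apply/eq_in_map => a.
rewrite wP => /andP[a0 am].
have /permP -> : perm_eq (undup w) (iota 1 m).
  apply: uniq_perm; rewrite ?undup_uniq ?iota_uniq // => b.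
  by rewrite mem_undup wP mem_iota; lia.
rewrite -(subnKC am) iotaD count_cat.
rewrite (_ : count _ (iota 1 a) = count predT (iota 1 a)); last first.
  by apply: eq_in_count => b; rewrite mem_iota /=; lia.
rewrite count_predT size_iota (_ : count _ _ = 0) ?addn0 //.
apply/eqP; rewrite -leqn0 leqNgt -has_count; apply/hasPn => b.
by rewrite mem_iota; lia.
Qed.

(** Flattening fixes w, so each letter b is the number of letters at most b; for
    the largest letter M this gives M distinct letters in {1, ..., M}, hence
    all of them. *)
Lemma packed_mem w : is_packed w -> forall a, (a \in w) = (0 < a <= wmax w).
Proof.
move=> /eqP flw a; apply/idP/andP => [aw|[a0 aM]].
  split; last exact: leq_wmax.
  rewrite -flw in aw; have /mapP[b bw ->] := aw.
  by rewrite -has_count; apply/hasP; exists b; rewrite ?mem_undup.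
have fle b : b \in w -> count (leq^~ b) (undup w) = b.
  move=> bw; have /(congr1 (nth 0 ^~ (index b w))) := flw.
  by rewrite /fl (nth_map 0) ?index_mem // nth_index.
have pos b : b \in w -> 0 < b.
  by move=> bw; rewrite -(fle _ bw) -has_count; apply/hasP; exists b;
    rewrite ?mem_undup.
have Mw : wmax w \in w.
  case: w a0 aM {flw fle pos} => [|b w] a0; first by rewrite /wmax big_nil; lia.
  move=> _; rewrite /wmax; elim: w b => [|c w IH] b.
    by rewrite big_seq1 inE.
  rewrite big_cons; have /= := IH c; set M := \max_(_ <- _) _ => Mw.
  by rewrite inE; case: (leqP b M) => bM; rewrite ?eqxx ?Mw ?orbT.
have sw : size (undup w) = wmax w.
  rewrite -[RHS]fle // -count_predT; apply: eq_in_count => b.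
  by rewrite mem_undup => /leq_wmax ->.
have sub : {subset undup w <= iota 1 (wmax w)}.
  by move=> b; rewrite mem_undup mem_iota => bw;
    rewrite pos //= add1n ltnS leq_wmax.
have [_ eqi] := uniq_min_size (undup_uniq w) sub
   (eq_leq (etrans (size_iota _ _) (esym sw))).
by rewrite -mem_undup eqi mem_iota a0 add1n ltnS.
Qed.

Definition slice m n w := wdown m (wrestrict m n w).

Lemma mem_slice m n w a :
  (a \in slice m n w) = [&& 0 < a, a + m \in w & a + m <= n].
Proof.
apply/mapP/and3P => [[b]|[a0 aw an]].
  rewrite mem_filter => /andP[/andP[mb bn] bw] ->.
  by split; rewrite ?subn_gt0 ?subnK ?(ltnW mb).
by exists (a + m); rewrite ?mem_filter ?aw ?addnK //; lia.
Qed.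

Lemma slice_mem m n w : is_packed w ->
  forall a, (a \in slice m n w) = (0 < a <= minn n (wmax w) - m).
Proof. by move=> /packed_mem wP a; rewrite mem_slice wP; lia. Qed.

Lemma slice_packed m n w : is_packed w -> is_packed (slice m n w).
Proof. by move=> /slice_mem wP; apply: interval_packed (wP _ _). Qed.

Lemma wmax_slice m n w : is_packed w ->
  wmax (slice m n w) = minn n (wmax w) - m.
Proof. by move=> /slice_mem wP; apply: wmax_interval (wP _ _). Qed.

Lemma slice_slice i j m n w :
  slice i j (slice m n w) = slice (m + i) (minn (m + j) n) w.
Proof.
rewrite /slice /wdown /wrestrict filter_map -filter_predI -map_comp.
rewrite (_ : seq.filter _ w = [seq a <- w | m + i < a <= minn (m + j) n]).
  by apply: eq_map => a /=; rewrite subnDA.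
by apply: eq_filter => a /=; lia.
Qed.

Lemma slice_all w : is_packed w -> slice 0 (wmax w) w = w.
Proof.
move=> /packed_mem wP; rewrite /slice /wdown (eq_map subn0) map_id.
by apply/all_filterP/allP => a; rewrite wP.
Qed.

Lemma slice_nil m n w : n <= m -> slice m n w = [::].
Proof.
move=> nm; rewrite /slice /wrestrict (@eq_filter _ _ pred0) ?filter_pred0 //.
by move=> a /=; lia.
Qed.

Lemma size_slice m w : is_packed w -> m <= wmax w ->
  size (slice 0 m w) + size (slice m (wmax w) w) = size w.
Proof.
move=> /packed_mem wP mM; rewrite !size_map !size_filter -count_predUI.
rewrite -[RHS]addn0; congr (_ + _).
  by rewrite -count_predT; apply: eq_in_count => a; rewrite wP /=; lia.
by apply/eqP; rewrite -leqn0 leqNgt -has_count; apply/hasPn => c _ /=; lia.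
Qed.

Lemma wmax_leq_size w : is_packed w -> wmax w <= size w.
Proof.
move=> /packed_mem wP; rewrite -[X in X <= _](size_iota 1).
by apply: uniq_leq_size (iota_uniq _ _) _ => a; rewrite mem_iota wP; lia.
Qed.

(** A set of positions defined by a condition on letters selects a filter of w:
    the sets occurring in shifted shuffles are of this kind. *)
Lemma subwordE w (P : pred nat) :
  subword [set i : 'I_(size w) | P (tnth (in_tuple w) i)] = seq.filter P w.
Proof.
have wE : w = [seq tnth (in_tuple w) p | p <- enum 'I_(size w)].
  by rewrite map_tnth_enum.
rewrite [in RHS]wE filter_map /subword; congr map.
rewrite {1}/enum_mem [in RHS]enumT; apply: eq_filter => p.
by rewrite !inE.
Qed.

End Words.

Definition packing (w : seq nat) : packed :=
  @Packed (fl w) (introT eqP (fl_fl w)).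
Definition slicep m n (w : packed) : packed :=
  Packed (slice_packed m n (valP w)).

Implicit Types (a b c u v w z : packed) (m n : nat).

Lemma slicep_nil (m : nat) (w : packed) : slicep m m w = packed0.
Proof. by apply: val_inj; rewrite /= slice_nil. Qed.

Lemma slicep_all (w : packed) : slicep 0 (wmax w) w = w.
Proof. by apply: val_inj; rewrite /= slice_all // (valP w). Qed.

Lemma slicep_slicep i j m n (w : packed) :
  slicep i j (slicep m n w) = slicep (m + i) (minn (m + j) n) w.
Proof. by apply: val_inj; rewrite /= slice_slice. Qed.

Lemma wmax_slicep m n (w : packed) :
  (wmax (slicep m n w) = minn n (wmax w) - m)%N.
Proof. by rewrite wmax_slice // (valP w). Qed.

Lemma size_slicep m (w : packed) : (m <= wmax w)%N ->
  (size (slicep 0 m w) + size (slicep m (wmax w) w) = size w)%N.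
Proof. by apply: size_slice; exact: (valP w). Qed.

Lemma packing_id (w : packed) : packing w = w.
Proof. by apply: val_inj; exact/eqP/(valP w). Qed.

Lemma wmax_eq0 (w : packed) : (wmax w == 0)%N = (w == packed0).
Proof.
apply/eqP/eqP => [w0|->]; last by rewrite /wmax big_nil.
by rewrite -(slicep_all w) w0 slicep_nil.
Qed.

Lemma size_eq0_packed (w : packed) : (size w == 0)%N = (w == packed0).
Proof. by rewrite size_eq0 -val_eqE. Qed.

Definition ptake i (w : packed) := packing (take i w).
Definition pdrop i (w : packed) := packing (drop i w).

Lemma size_ptake i w : (i <= size w)%N -> size (ptake i w) = i.
Proof. by move=> iw; rewrite /= size_fl size_takel. Qed.

Lemma size_pdrop i w : (size (pdrop i w) = size w - i)%N.
Proof. by rewrite /= size_fl size_drop. Qed.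

Lemma ptake_size w : ptake (size w) w = w.
Proof. by rewrite /ptake take_size packing_id. Qed.

Lemma pdrop0 w : pdrop 0 w = w.
Proof. by rewrite /pdrop drop0 packing_id. Qed.

Lemma ptake_ptake i j w : (i <= j)%N -> ptake i (ptake j w) = ptake i w.
Proof. by move=> ij; apply: val_inj; rewrite /= fl_take take_takel. Qed.

Lemma pdrop_pdrop i j w : pdrop i (pdrop j w) = pdrop (i + j) w.
Proof. by apply: val_inj; rewrite /= fl_drop drop_drop. Qed.

Lemma pdrop_ptake i j w : pdrop i (ptake (i + j) w) = ptake j (pdrop i w).
Proof. by apply: val_inj; rewrite /= fl_drop fl_take take_drop addnC. Qed.

(** Letters of a packed word are at most its length, so that the packed words of
    length n are among the sequences of n letters in {0, ..., n}. *)
Definition packed_words (n : nat) : seq packed :=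
  pmap insub [seq map val (tval t) | t : n.-tuple 'I_n.+1].

Lemma packed_words_uniq n : uniq (packed_words n).
Proof.
apply: pmap_uniq; first exact: (@insubK _ _ packed).
rewrite map_inj_uniq ?enum_uniq // => s t /inj_map st; apply: val_inj.
by apply: st; exact: val_inj.
Qed.

Lemma mem_packed_words n (w : packed) : (w \in packed_words n) = (size w == n).
Proof.
rewrite mem_pmap_sub; apply/mapP/eqP => [[t _ ->]|sw].
  by rewrite size_map size_tuple.
have sz : size (map (@inord n) w) == n by rewrite size_map sw.
exists (Tuple sz); rewrite ?mem_enum //= -map_comp -[LHS]map_id.
apply/eq_in_map => a /= aw; rewrite inordK // ltnS -sw.
exact: leq_trans (leq_wmax aw) (wmax_leq_size (valP w)).
Qed.

(** * Product and coproduct in coordinates *)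

(** The letters of u are at most [wmax u] and those of the shifted v are
    greater, so the positions of u in a shuffle can be read off the letters:
    w arises at most once, and only from its own two pieces. *)
Lemma shuffle_coefE (u v w : packed) :
  shuffle_coef u (wup (wmax u) v) w =
  ((u == slicep 0 (wmax u) w) && (v == slicep (wmax u) (wmax w) w)) :> nat.
Proof.
set m := wmax u.
set A0 := [set i : 'I_(size w) | (tnth (in_tuple w) i <= m)%N]%SET.
have sA0 : subword A0 = slice 0 m w.
  rewrite (subwordE w (leq^~ m)) /slice /wdown (eq_map subn0) map_id.
  apply: eq_in_filter => a; rewrite (packed_mem (valP w)); lia.
have sA0C : (subword (~: A0) == wup m v) = (v == slicep m (wmax w) w).
  have -> : ~: A0 = [set i : 'I_(size w) | (m < tnth (in_tuple w) i)%N]%SET.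
    by apply/setP => i; rewrite !inE ltnNge.
  rewrite (subwordE w (fun q => m < q)%N) -val_eqE /=.
  have -> : slice m (wmax w) w = wdown m (seq.filter (fun q => m < q)%N w).
    congr wdown; apply: eq_in_filter => a /leq_wmax aw /=; lia.
  apply/eqP/eqP => [->|->].
    by rewrite /wdown /wup -map_comp (eq_map (addnK m)) map_id.
  rewrite /wdown /wup -map_comp -[LHS]map_id; apply/eq_in_map => a.
  by rewrite mem_filter /= => /andP[ma _]; rewrite subnK 1?ltnW.
rewrite /shuffle_coef.
set c := _ && _; rewrite (@eq_card _ _ [pred A | (A == A0) && c]).
  case: c; last by rewrite eq_card0 // => A; rewrite !inE andbF.
  by rewrite (@eq_card _ _ (pred1 A0)) ?card1 // => A; rewrite !inE ?andbT.
move=> A; rewrite !inE; have [->|AA0] := eqVneq A A0.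
  by rewrite sA0 sA0C /c -[u == _]val_eqE eq_sym.
apply: contraNF AA0 => /andP[/eqP Au /eqP Av]; apply/eqP/setP => i.
rewrite inE; case: (boolP (i \in A)) => iA; symmetry.
  by apply: leq_wmax; rewrite -Au; apply: map_f; rewrite mem_enum.
have : tnth (in_tuple w) i \in wup m v.
  by rewrite -Av; apply: map_f; rewrite mem_enum inE.
by case/mapP => b; rewrite (packed_mem (valP v)) => /andP[b0 _] ->; lia.
Qed.

Lemma wmax_packed0 : wmax packed0 = 0%N.
Proof. exact: big_nil. Qed.

(** The (a, b)-destandardizations; see [destandardizationP]. *)
Definition cuts a b : seq packed :=
  [seq z <- packed_words (size a + size b) |
    (ptake (size a) z == a) && (pdrop (size a) z == b)].

Section Hopf.
Variable k : fieldType.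
Implicit Types (f g : packed -> k).

Lemma hmulE (x : packed * packed -> k) w :
  hmul (W_P k) x w =
  \sum_(0 <= m < (wmax w).+1) x (slicep 0 m w, slicep m (wmax w) w).
Proof.
rewrite /= /lc_extend /lc_sum /mul_sh.
have wlo m : (m < (wmax w).+1)%N -> wmax (slicep 0 m w) = m.
  by move=> mM; rewrite wmax_slicep; lia.
rewrite (@fsum_seq _ _ [seq (slicep 0 m w, slicep m (wmax w) w) | m <-
  index_iota 0 (wmax w).+1]).
- rewrite big_map; apply: eq_big_nat => m /andP[_ /wlo mM].
  by rewrite -[_.1]/(slicep 0 m w) -[_.2]/(slicep m (wmax w) w) shuffle_coefE
    mM !eqxx mulr1.
- rewrite map_inj_in_uniq ?iota_uniq // => m n.
  rewrite !mem_index_iota => /andP[_ /wlo mM] /andP[_ /wlo nM] [/(congr1 wmax)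
    E _].
  exact: etrans (etrans (esym mM) E) nM.
case=> u v nuv; rewrite /= shuffle_coefE; case: eqP => [uE|];
  last by rewrite mulr0.
case: eqP => [vE|]; last by rewrite mulr0.
case/mapP: nuv; exists (wmax u); last by rewrite -uE -vE.
have := congr1 (wmax \o word_of) uE; rewrite mem_index_iota /= -/(slicep _ _ _)
  wmax_slicep; lia.
Qed.

Definition coprod f a b : k := \sum_(z <- cuts a b) f z.

Lemma coprodE f a b : coprod f a b =
  \sum_(z <- packed_words (size a + size b) |
    (ptake (size a) z == a) && (pdrop (size a) z == b)) f z.
Proof. exact: big_filter. Qed.

(** The only cut of z giving words of the lengths of a and b is after the first
    [size a] letters. *)
Lemma hcomulE f a b : hcomul (W_P k) f (a, b) = coprod f a b.
Proof.
rewrite /= /lc_extend /lc_sum /comul_odot /=.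
have inner z : \sum_(i < (size z).+1) ((fl (take i z) == a) &&
  (fl (drop i z) == b))%:R
   = ((size z == size a + size b)%N && ((ptake (size a) z == a) &&
     (pdrop (size a) z == b)))%:R :> k.
  have [sz|nsz] /= := eqVneq; last first.
    rewrite big1 // => i _; case: eqP => //= ta; case: eqP => //= db.
    case/eqP: nsz; have := congr1 size ta; have := congr1 size db.
    by rewrite !size_fl size_drop size_takel; have := ltn_ord i; lia.
  have ia : (size a < (size z).+1)%N by lia.
  rewrite (bigD1 (Ordinal ia)) //= big1 ?addr0 // => i /eqP ni.
  case: eqP => //= ta; case: ni; apply: val_inj => /=.
  by rewrite -ta size_fl size_takel // -ltnS.
under eq_fsbigr do rewrite inner.
rewrite (@fsum_seq _ _ (packed_words (size a + size b))) ?packed_words_uniq //.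
  rewrite coprodE [RHS]big_mkcond /=; apply: eq_big_seq => z.
  by rewrite mem_packed_words => -> /=; case: ifP; rewrite ?mulr1 ?mulr0.
by move=> z; rewrite mem_packed_words => /negPf ->; rewrite mulr0.
Qed.

Lemma big_seq1_eq (T : eqType) (r : seq T) (h : T -> k) x :
  uniq r -> x \in r -> \sum_(y <- r | y == x) h y = h x.
Proof.
move=> ur xr; rewrite big_mkcond (bigD1_seq x) //= eqxx big1 ?addr0 //.
by move=> y /negPf ->.
Qed.

Lemma coprod0r f a : coprod f a packed0 = f a.
Proof.
rewrite /coprod /cuts addn0
  (_ : seq.filter _ _ = [seq z <- packed_words (size a) | z == a]).
  by rewrite big_filter big_seq1_eq ?packed_words_uniq ?mem_packed_words.
apply: eq_in_filter => z; rewrite mem_packed_words => /eqP sz.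
by rewrite -sz ptake_size -size_eq0_packed size_pdrop subnn eqxx andbT.
Qed.

Lemma coprod0l f b : coprod f packed0 b = f b.
Proof.
rewrite /coprod /cuts add0n
  (_ : seq.filter _ _ = [seq z <- packed_words (size b) | z == b]).
  by rewrite big_filter big_seq1_eq ?packed_words_uniq ?mem_packed_words.
by apply: eq_in_filter => z _; rewrite pdrop0 -size_eq0_packed size_ptake.
Qed.

Lemma eq_coprod f g a b : (forall z, size z = size a + size b -> f z = g z)%N ->
  coprod f a b = coprod g a b.
Proof.
move=> fg; apply: eq_big_seq => z.
by rewrite mem_filter mem_packed_words => /andP[_ /eqP /fg].
Qed.

Lemma coprod_lin (x : k) f g a b :
  coprod (fun z => x * f z + g z) a b = x * coprod f a b + coprod g a b.
Proof. by rewrite /coprod big_split /= mulr_sumr. Qed.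

(** Both sides sum f over the words whose three consecutive pieces flatten to a,
    b and c, since flattening a word first does not change how its pieces
    flatten. *)
Lemma coprodA f a b c :
  coprod (fun u => coprod f u c) a b = coprod (fun v => coprod f a v) b c.
Proof.
set i := size a; set j := size b; set l := size c.
pose r := packed_words (i + j + l).
transitivity (\sum_(z <- r | [&& ptake i z == a, ptake j (pdrop i z) == b &
  pdrop (i + j) z == c]) f z).
  rewrite coprodE -/i -/j -/l big_seq_cond.
  rewrite (eq_bigr (fun u => \sum_(z <- r | (ptake (i + j) z == u) &&
    (pdrop (i + j) z == c)) f z)); last first.
    by move=> u /andP[]; rewrite coprodE mem_packed_words => /eqP ->.
  rewrite -big_seq_cond.
  rewrite (exchange_big_dep xpredT) //= [RHS]big_mkcond /=.
  apply: eq_big_seq => z; rewrite mem_packed_words => /eqP sz.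
  rewrite (eq_bigl (fun u => [&& ptake i z == a, ptake j (pdrop i z) == b &
    pdrop (i + j) z == c] && (u == ptake (i + j) z))).
    case: ifP => _; last by rewrite big_pred0.
    by rewrite big_seq1_eq ?packed_words_uniq // mem_packed_words size_ptake;
      lia.
  move=> u; have [->|] := eqVneq u (ptake (i + j) z).
    by rewrite ptake_ptake ?leq_addr // pdrop_ptake /= andbT -andbA.
  by rewrite !andbF.
rewrite [RHS]coprodE -/i -/j -/l [RHS]big_seq_cond.
rewrite [RHS](eq_bigr (fun v => \sum_(z <- r | (ptake i z == a) &&
  (pdrop i z == v)) f z)); last first.
  by move=> v /andP[]; rewrite coprodE mem_packed_words => /eqP ->;
    rewrite addnA.
rewrite -big_seq_cond.
rewrite (exchange_big_dep xpredT) //= [LHS]big_mkcond /=.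
apply: eq_big_seq => z; rewrite mem_packed_words => /eqP sz.
rewrite (eq_bigl (fun v => [&& ptake i z == a, ptake j (pdrop i z) == b & pdrop
  (i + j) z == c] && (v == pdrop i z))).
  case: ifP => _; last by rewrite big_pred0.
  by rewrite big_seq1_eq ?packed_words_uniq // mem_packed_words size_pdrop; lia.
move=> v; have [->|] := eqVneq v (pdrop i z).
  by rewrite pdrop_pdrop !andbT [(j + i)%N]addnC andbC.
by rewrite !andbF.
Qed.

(** * The antipode *)

(** The recursion is on the largest letter of w; n is an upper bound for it. *)
Fixpoint antipode_rec n f w : k :=
  if n isn't n'.+1 then f packed0 else
  if w == packed0 then f packed0 else
  - \sum_(0 <= m < wmax w)
      antipode_rec n' (fun u => coprod f u (slicep m (wmax w) w))
        (slicep 0 m w).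

Definition antipode f w := antipode_rec (wmax w) f w.

Lemma antipode0 f : antipode f packed0 = f packed0.
Proof. by rewrite /antipode; case: wmax. Qed.

Lemma antipode_recE n f w :
  (wmax w <= n)%N -> antipode_rec n f w = antipode f w.
Proof.
suff H n' : (wmax w <= n')%N -> (wmax w <= n)%N ->
    antipode_rec n f w = antipode_rec n' f w by exact: H.
elim: n n' f w => [|n IH] [|n'] f w /=.
- by [].
- by rewrite leqn0 wmax_eq0 => _ -> .
- by rewrite leqn0 wmax_eq0 => -> _.
move=> wn' wn; case: ifP => // _; congr (- _); apply: eq_big_nat => m mw.
by apply: IH; rewrite wmax_slicep; lia.
Qed.

Lemma antipodeE f w : w != packed0 ->
  antipode f w = - \sum_(0 <= m < wmax w)
    antipode (fun u => coprod f u (slicep m (wmax w) w)) (slicep 0 m w).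
Proof.
move=> w0; have := w0; rewrite -wmax_eq0 /antipode.
case wM: (wmax w) => [|M] //= _; rewrite (negPf w0) wM; congr (- _).
by apply: eq_big_nat => m mw; apply: antipode_recE; rewrite wmax_slicep; lia.
Qed.

Lemma packed_ind (P : packed -> Prop) :
  (forall w, (forall w', (wmax w' < wmax w)%N -> P w') -> P w) -> forall w, P w.
Proof.
move=> H w; move: {2}(wmax w) (leqnn (wmax w)) => n.
elim: n w => [|n IH] w wn; apply: H => w' w'w; first by lia.
by apply: IH; lia.
Qed.

Lemma wmax_gt0 w : w != packed0 -> (0 < wmax w)%N.
Proof. by rewrite -wmax_eq0 lt0n. Qed.

(** Homogeneity of the antipode, from which both its continuity and the
    stability of finite support follow. *)
Lemma antipode_eq w f g : (forall z, size z = size w -> f z = g z) ->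
  antipode f w = antipode g w.
Proof.
elim/packed_ind: w f g => w IH f g fg.
have [w0|w0] := eqVneq w packed0; first by rewrite w0 !antipode0 fg ?w0.
rewrite !antipodeE //; congr (- _); apply: eq_big_nat => m /andP[_ mw].
apply: IH => [|u su]; first by rewrite wmax_slicep; lia.
by apply: eq_coprod => z; rewrite su size_slicep 1?ltnW // => /fg.
Qed.

Lemma antipode_lin (x : k) f g w :
  antipode (fun z => x * f z + g z) w = x * antipode f w + antipode g w.
Proof.
elim/packed_ind: w f g => w IH f g.
have [w0|w0] := eqVneq w packed0; first by rewrite w0 !antipode0.
rewrite !antipodeE // mulrN mulr_sumr -opprD -big_split /=; congr (- _).
apply: eq_big_nat => m /andP[_ mw]; rewrite -IH; last by rewrite wmax_slicep;
  lia.
by apply: antipode_eq => z _; rewrite coprod_lin.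
Qed.

Lemma antipode_morphism : lc_morphism antipode.
Proof.
split; first by move=> x f g _ _; apply/funext => w; exact: antipode_lin.
apply: finitary_continuous => w; exists (packed_words (size w)) => f g fg.
by apply: antipode_eq => z sz; apply: fg; rewrite mem_packed_words sz.
Qed.

Lemma id_morphism : lc_morphism (@id (packed -> k)).
Proof.
split; first by [].
by apply: finitary_continuous => w; exists [:: w] => f g; apply; rewrite inE.
Qed.

(** Peeling off the last piece and then, by induction, the first piece of what
    remains, gives the same double sum over l <= m as peeling off in the
    other order; coassociativity identifies the summands. In both expansions
    the term with a trivial piece is f w. *)
Lemma antipode_right f w : w != packed0 ->
  antipode f w = - \sum_(1 <= m < (wmax w).+1)
    antipode (fun v => coprod f (slicep 0 m w) v) (slicep m (wmax w) w).
Proof.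
elim/packed_ind: w f => w IH f w0; have M0 := wmax_gt0 w0.
rewrite antipodeE //; congr (- _); set M := wmax w.
rewrite big_ltn // slicep_nil antipode0 [RHS]big_nat_recr //= slicep_nil
  antipode0 [RHS]addrC.
rewrite slicep_all coprod0l coprod0r; congr (_ + _).
(* F l m is the contribution of the three pieces cut at l and m. *)
pose F l m := antipode
  (fun x => coprod (fun y => coprod f y (slicep m M w)) (slicep 0 l w) x)
  (slicep l m w).
transitivity (- \sum_(1 <= m < M) \sum_(1 <= l < M | (l <= m)%N) F l m).
  rewrite -sumrN; apply: eq_big_nat => m /andP[m0 mM].
  have wm : wmax (slicep 0 m w) = m by rewrite wmax_slicep; lia.
  rewrite IH ?wm //; last by rewrite -wmax_eq0 wm; lia.
  congr (- _); rewrite (big_nat_widen _ _ M) ?wm //=.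
  apply: eq_big => [l|l lm] //.
  by rewrite /F slicep_slicep slicep_slicep !add0n /= (minn_idPl _) //  minnn.
rewrite (exchange_big_dep_nat (fun=> true)) //= -sumrN.
apply: eq_big_nat => l /andP[l0 lM].
have wl : wmax (slicep l M w) = (M - l)%N by rewrite wmax_slicep minnn.
rewrite antipodeE; last by rewrite -wmax_eq0 wl; lia.
congr (- _).
rewrite -(big_nat_widenl l 1 M (fun=> true)) //.
rewrite -{1}[l]add0n big_addn wl; apply: eq_big_nat => m /andP[_ mM].
rewrite /F !slicep_slicep addn0 subnKC 1?ltnW // minnn addnC (minn_idPl _);
  last by lia.
by apply: antipode_eq => z _; rewrite coprodA.
Qed.

Lemma tensor_antipodel f a b :
  tensor_map antipode id (hcomul (W_P k) f) (a, b) =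
  antipode (fun u => coprod f u b) a.
Proof.
rewrite tensor_mapE ?id //; [|exact: antipode_morphism|exact: id_morphism].
by apply: antipode_eq => z _; rewrite hcomulE.
Qed.

Lemma tensor_antipoder f a b :
  tensor_map id antipode (hcomul (W_P k) f) (a, b) =
  antipode (fun v => coprod f a v) b.
Proof.
rewrite tensor_mapE //; [|exact: id_morphism|exact: antipode_morphism].
by apply: antipode_eq => z _; rewrite hcomulE.
Qed.

Lemma antipodeP (D : set (packed -> k)) : antipode_on (W_P k) D antipode.
Proof.
move=> f _; split; apply/funext => w; rewrite hmulE /= /delta.
- under eq_bigr do rewrite tensor_antipodel.
  have [->|w0] := eqVneq w packed0.
    by rewrite mulr1 wmax_packed0 big_nat1 !slicep_nil antipode0 coprod0l.
  rewrite mulr0 big_nat_recr //= slicep_all slicep_nil [X in _ + X](_ : _ =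
    antipode f w).
    by rewrite [X in _ + X]antipodeE // subrr.
  by apply: antipode_eq => z _; rewrite coprod0r.
- under eq_bigr do rewrite tensor_antipoder.
  have [->|w0] := eqVneq w packed0.
    by rewrite mulr1 wmax_packed0 big_nat1 !slicep_nil antipode0 coprod0l.
  rewrite mulr0 big_ltn //= slicep_all slicep_nil [X in X + _](_ : _ = antipode
    f w).
    by rewrite [X in X + _]antipode_right // addNr.
  by apply: antipode_eq => z _; rewrite coprod0l.
Qed.

End Hopf.

(** * Functions with finite support *)

(** The counting clause of P-algebraicity compares numbers as elements of the
    field. *)
Lemma natr_eqP (k : fieldType) m n :
  (m%:R == n%:R :> k) <->
  ([pchar k] =i pred0 -> m = n) /\
  (forall p, p \in [pchar k] -> m = n %[mod p]).
Proof.
split=> [/eqP mn|[h0 hp]].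
  wlog nm : m n mn / (n <= m)%N => [H|].
    case/orP: (leq_total n m) => [/H|/(H _ _ (esym mn)) [h0 hp]]; first exact.
    by split=> [/h0 ->|p /hp ->].
  have mn0 : (m - n)%:R = 0 :> k by rewrite natrB // mn subrr.
  split=> [/pcharf0P chk|p chp].
    by apply/eqP; rewrite eqn_leq nm andbT -subn_eq0 -chk mn0.
  by apply/eqP; rewrite eqn_mod_dvd // (dvdn_pcharf chp) mn0.
have [[p chp]|np] := pselect (exists p, p \in [pchar k]).
  by rewrite -(GRing.natr_mod_pchar chp) hp // GRing.natr_mod_pchar.
by rewrite h0 // => p; rewrite [RHS]inE; apply/negP => chp; apply: np; exists p.
Qed.

Section FiniteSupport.
Variable k : fieldType.

Lemma finsupp_lin (I : Type) n (e : 'I_n -> k) (h : 'I_n -> I -> k) :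
  (forall t, finsupp (h t)) -> finsupp (fun i => \sum_(t < n) e t * h t i).
Proof.
move=> hfin; apply: sub_finite_set (bigcup_finite finite_finset (fun t _ =>
  hfin t)).
move=> i /= si; apply: contrapT => ni; case/eqP: si; apply: big1 => t _.
rewrite [h t i](_ : _ = 0) ?mulr0 //; apply/eqP/negPn/negP => hti.
by apply: ni; exists t.
Qed.

Lemma finsupp_tensor (I J : Type) (f : I -> k) (g : J -> k) :
  finsupp f -> finsupp g -> finsupp (tensor f g).
Proof.
move=> ff fg; apply: sub_finite_set (finite_setX ff fg) => -[i j] /=.
by rewrite mulf_eq0 negb_or => /andP.
Qed.

(** A finitely supported function that is constant on the fibres of r is the
    combination of the indicators of the fibres it does not vanish on; the
    values of r serve as representatives of the fibres. *)
Lemma span_retract (I : choiceType) (r : I -> I) (B : set (I -> k))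
    (f : I -> k) :
  (forall i, B (fun j => (r j == r i)%:R)) -> finsupp f ->
  (forall i, f (r i) = f i) -> span B f.
Proof.
move=> Br /finite_seqP [s sE] fr.
pose R := undup [seq r i | i <- s].
have Rr (t : 'I_(size R)) : exists i, tnth (in_tuple R) t = r i.
  have := mem_tnth t (in_tuple R); rewrite mem_undup => /mapP [i _ ->].
  by exists i.
exists (size R), (fun t j => (r j == tnth (in_tuple R) t)%:R),
  (fun t => f (tnth (in_tuple R) t)).
split=> [t|]; first by have [i ->] := Rr t; exact: Br.
apply/funext => i.
rewrite -(big_tnth _ _ R xpredT (fun x => f x * (r i == x)%:R)) /=.
have [riR|riR] := boolP (r i \in R).
  rewrite (bigD1_seq _ riR) ?undup_uniq //= eqxx mulr1 fr big1 ?addr0 // => x.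
  by rewrite eq_sym => /negPf ->; rewrite mulr0.
rewrite big1_seq => [|x /= xR].
  apply/eqP; apply: contraNT riR => fi; rewrite mem_undup; apply: map_f.
  by have : [set i | f i != 0] i by []; rewrite sE.
by case: eqP => [rx|]; rewrite ?mulr0 //; rewrite rx xR in riR.
Qed.

(** When d takes each value finitely often, bounded degree and finite support
    are the same thing; bounds are easier to follow through graded maps. *)
Definition bounded (I : Type) (d : I -> nat) (f : I -> k) :=
  exists n, forall i, (n < d i)%N -> f i = 0.

Lemma finsupp_bounded (I : choiceType) (d : I -> nat) (f : I -> k) :
  finsupp f -> bounded d f.
Proof.
move=> /finite_seqP [s sE]; exists (\max_(i <- s) d i)%N => i di.
apply/eqP/negPn/negP => fi; have : [set i | f i != 0] i by [].
rewrite sE /= => si; have := @leq_bigmax_seq _ s xpredT d i si isT; lia.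
Qed.

Lemma bounded_finsupp (I : choiceType) (d : I -> nat) (f : I -> k) :
  (forall n, exists s : seq I, forall i, (d i <= n)%N -> i \in s) ->
  bounded d f -> finsupp f.
Proof.
move=> dfin [n fn]; have [s sP] := dfin n.
apply: sub_finite_set (finite_seq s) => i /= fi; apply: sP.
by rewrite leqNgt; apply: contra fi => /fn ->.
Qed.

End FiniteSupport.

Definition packed_words_le n : seq packed :=
  flatten [seq packed_words m | m <- iota 0 n.+1].

Lemma mem_packed_words_le n w : (size w <= n)%N -> w \in packed_words_le n.
Proof.
move=> wn; apply/flattenP; exists (packed_words (size w));
  last by rewrite mem_packed_words.
by apply: map_f; rewrite mem_iota.
Qed.

Definition size2 (p : packed * packed) := (size p.1 + size p.2)%N.

Section FiniteSupportHopf.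
Variable k : fieldType.
Implicit Types f g : packed -> k.

Lemma bounded_size f : bounded (fun w => size w) f <-> finsupp f.
Proof.
split; last exact: finsupp_bounded.
by apply: bounded_finsupp => n; exists (packed_words_le n) => w;
  exact: mem_packed_words_le.
Qed.

Lemma bounded_size2 (x : packed * packed -> k) : bounded size2 x <-> finsupp x.
Proof.
split; last exact: finsupp_bounded.
apply: bounded_finsupp => n;
  exists [seq (a, b) | a <- packed_words_le n, b <- packed_words_le n].
case=> a b; rewrite /size2 /= => ab.
by apply: allpairs_f; apply: mem_packed_words_le; lia.
Qed.

Lemma finsupp_hmul x : finsupp x -> finsupp (hmul (W_P k) x).
Proof.
move=> /bounded_size2 [n xn]; apply/bounded_size; exists n => w nw.
rewrite hmulE big_nat big1 // => m mM; apply: xn.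
by rewrite /size2 size_slicep.
Qed.

Lemma finsupp_hcomul f : finsupp f -> finsupp (hcomul (W_P k) f).
Proof.
move=> /bounded_size [n fn]; apply/bounded_size2; exists n => -[a b] nab.
rewrite hcomulE /coprod big1_seq // => z /=.
by rewrite mem_filter mem_packed_words => /andP[_ /eqP sz]; apply: fn;
  rewrite sz.
Qed.

Lemma finsupp_antipode f : finsupp f -> finsupp (antipode f).
Proof.
move=> /bounded_size [n fn]; apply/bounded_size; exists n => w nw.
rewrite -(lc_morphism0 (antipode_morphism k) w).
by apply: antipode_eq => z zw; rewrite fn ?zw.
Qed.

End FiniteSupportHopf.

(** * Functions constant on classes *)

Lemma destandardizationP a b (w : seq nat) :
  destandardization a b w <-> exists2 z, z \in cuts a b & w = z.
Proof.
split=> [[pw [u' [v' [wu wv wE uE vE]]]]|[z zab ->]].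
  exists (Packed pw) => //; rewrite mem_filter mem_packed_words /=.
  rewrite -!val_eqE /= wE size_cat -uE -vE !size_fl eqxx andbT.
  by rewrite take_size_cat ?drop_size_cat ?eqxx.
move: zab; rewrite mem_filter => /andP[/andP[/eqP ta /eqP db] _].
split; first exact: (valP z).
exists (take (size a) z), (drop (size a) z); split.
- apply/negP => /mem_take; by rewrite (packed_mem (valP z)).
- apply/negP => /mem_drop; by rewrite (packed_mem (valP z)).
- by rewrite cat_take_drop.
- by rewrite -[in RHS]ta.
- by rewrite -[in RHS]db.
Qed.

Section Classes.
Variable sim : seq nat -> seq nat -> Prop.
Hypothesis simP : word_relation sim.

Lemma sim_refl w : sim w w.
Proof.
case: simP => + _ _ _; apply; apply/negP.
by rewrite (packed_mem (valP w)).
Qed.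

Lemma sim_sym (v w : seq nat) : sim v w -> sim w v.
Proof. by case: simP => _ + _ _; apply. Qed.

Lemma sim_trans (u v w : seq nat) : sim u v -> sim v w -> sim u w.
Proof. by case: simP => _ _ + _; apply. Qed.

Lemma sim_mem (v w : seq nat) : sim v w -> v =i w.
Proof. by case: simP => _ _ _ H /H []. Qed.

Lemma sim_wmax (v w : seq nat) : sim v w -> wmax v = wmax w.
Proof. by move=> /sim_mem; exact: wmax_eq_mem. Qed.

Definition sim_class w : set packed := [set v : packed | sim w v].

Lemma sim_class_eq v w : sim v w -> sim_class v = sim_class w.
Proof.
move=> vw; apply/seteqP; split=> u /= h; first exact: sim_trans (sim_sym vw) h.
exact: sim_trans vw h.
Qed.

(** The default value is the same for all w, so that the representative only
    depends on the class. *)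
Definition rep w : packed := xget packed0 (sim_class w).

Lemma sim_rep w : sim w (rep w).
Proof. by apply: (@xgetPex _ packed0 (sim_class w)); exists w; exact: sim_refl.
Qed.

Lemma rep_eqP v w : rep v = rep w <-> sim v w.
Proof.
split=> [vw|/sim_class_eq vw]; last by rewrite /rep vw.
by apply: sim_trans (sim_rep v) _; rewrite vw; apply: sim_sym; exact: sim_rep.
Qed.

Lemma rep_rep w : rep (rep w) = rep w.
Proof. by apply/rep_eqP; apply: sim_sym; exact: sim_rep. Qed.

Lemma ndestdE a b (x : seq nat) :
  ndestd sim a b x = count (fun z : packed => `[< sim x z >]) (cuts a b).
Proof.
rewrite /ndestd; set r := [seq word_of z | z <- cuts a b & `[< sim x z >]].
have -> : [set w | sim x w /\ destandardization a b w] =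
    [set` [fset w in r]%fset].
  apply/seteqP; split=> w /=; rewrite inE.
    move=> [xw /destandardizationP [z zab wz]]; rewrite wz; apply: map_f.
    by rewrite mem_filter zab andbT; apply/asboolP; rewrite -wz.
  case/mapP => z; rewrite mem_filter => /andP[/asboolP xz zab] ->.
  by split=> //; apply/destandardizationP; exists z.
rewrite set_fsetK card_fseq undup_id ?size_map ?size_filter //.
by rewrite map_inj_uniq ?filter_uniq ?packed_words_uniq //; exact: val_inj.
Qed.

Variable k : fieldType.
Implicit Types f g : packed -> k.

Definition invariant f := forall v w, sim v w -> f v = f w.

Definition invariant2 (x : packed * packed -> k) := forall a a' b b',
  sim a a' -> sim b b' -> x (a, b) = x (a', b').

Lemma invariant_rep f : invariant f -> forall w, f (rep w) = f w.
Proof. by move=> fi w; apply: fi; apply: sim_sym; exact: sim_rep. Qed.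

Lemma kappa_asbool w v : kappa k (sim_class w) v = (`[< sim w v >])%:R.
Proof.
by rewrite /kappa; congr (_%:R); congr nat_of_bool; apply/idP/asboolP;
  rewrite inE.
Qed.

Lemma kappaE w v : kappa k (sim_class w) v = (rep v == rep w)%:R.
Proof.
rewrite kappa_asbool; congr (_%:R); congr nat_of_bool; apply/asboolP/eqP.
  by move=> wv; apply/rep_eqP; exact: sim_sym.
by move=> /rep_eqP; exact: sim_sym.
Qed.

Lemma kappa_invariant w : invariant (kappa k (sim_class w)).
Proof. by move=> u v /rep_eqP uv; rewrite !kappaE uv. Qed.

Lemma K_P_hatE : K_P_hat k sim = invariant.
Proof.
have lc_sumE (e : set packed -> k) w :
    lc_sum (packed_classes sim) (@kappa k) e w = e (sim_class w).
  rewrite /lc_sum (fsbigE [:: sim_class w]) //=.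
  - rewrite big_mkcond big_seq1 ifT; last by rewrite inE; exists w.
    by rewrite kappaE eqxx mulr1.
  - by move=> E /=; rewrite inE => /eqP ->; exists w.
  move=> E [v EE]; have {}EE : E = sim_class v by [].
  rewrite inE => /eqP nE; rewrite EE kappaE.
  case: eqP => [/rep_eqP wv|]; last by rewrite mulr0.
  by case: nE; rewrite EE -(sim_class_eq wv).
apply/seteqP; split=> [f [e _ <-] v w vw|f fi];
  first by rewrite !lc_sumE (sim_class_eq vw).
exists (fun E => f (xget packed0 E)) => //; apply/funext => w.
by rewrite lc_sumE invariant_rep.
Qed.

Lemma coprod_kappa w a b :
  coprod (kappa k (sim_class w)) a b = (ndestd sim a b w)%:R.
Proof.
rewrite /coprod ndestdE -sum1_count [in RHS]big_mkcond natr_sum.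
by apply: eq_bigr => z _; rewrite kappa_asbool; case: ifP.
Qed.

(** Grouping the cuts by classes: the coproduct of an invariant function depends
    on (a, b) only through the destandardization counts. The list r of
    representatives only has to contain those of the cuts, so that two pairs
    can share it. *)
Lemma coprod_invariant f a b (r : seq packed) : invariant f ->
  uniq r -> {subset map rep (cuts a b) <= r} -> {in r, forall w, rep w = w} ->
  coprod f a b = \sum_(w <- r) f w * (ndestd sim a b w)%:R.
Proof.
move=> fi ur cr rr; under eq_bigr do rewrite -coprod_kappa mulr_sumr.
rewrite exchange_big; apply: eq_big_seq => z zab /=.
rewrite (bigD1_seq (rep z)) ?cr ?map_f //= kappaE rep_rep eqxx mulr1.
rewrite invariant_rep // big_seq_cond big1 ?addr0 // => w /andP[wr wz].
by rewrite kappaE (rr w) // eq_sym (negPf wz) mulr0.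
Qed.

(** Only the summand m = [wmax a] can contribute, as sim-related words have the
    same largest letter. *)
Lemma hmul_kappa a b w :
  hmul (W_P k) (tensor (kappa k (sim_class a)) (kappa k (sim_class b))) w =
  (`[< sim a (slicep 0 (wmax a) w) /\ sim b (slicep (wmax a) (wmax w) w) >])%:R.
Proof.
rewrite hmulE /tensor /=.
have [am|am] := leqP (wmax a) (wmax w); last first.
  rewrite big_nat big1 => [|m mM].
    case: asboolP => // -[/sim_wmax]; rewrite wmax_slice ?(valP w) //; lia.
  rewrite kappa_asbool; case: asboolP => [/sim_wmax|]; rewrite ?mul0r //.
  rewrite wmax_slicep; lia.
rewrite (bigD1_seq (wmax a)) ?iota_uniq ?mem_index_iota //=.
rewrite big_seq_cond big1 ?addr0 => [|m].
  by rewrite !kappa_asbool -natrM mulnb; congr (_%:R); congr nat_of_bool;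
    rewrite asbool_and.
rewrite mem_index_iota => /andP[/andP[_ mM] ma].
rewrite kappa_asbool; case: asboolP => [/sim_wmax|]; rewrite ?mul0r //.
rewrite wmax_slicep; lia.
Qed.

(** * Closed subspaces give P-algebraic relations *)

(** The argument is the same for the completed and for the graded statement: L
    is a space of invariant functions, LL its tensor square. *)
Section Necessity.
Variables (L : set (packed -> k)) (LL : set (packed * packed -> k)).
Hypothesis L_inv : L `<=` invariant.
Hypothesis LL_inv : LL `<=` invariant2.
Hypothesis L_kappa : forall w, L (kappa k (sim_class w)).
Hypothesis LL_kappa : forall v w,
  LL (tensor (kappa k (sim_class v)) (kappa k (sim_class w))).
Hypothesis L_mul : forall x, LL x -> L (hmul (W_P k) x).
Hypothesis L_comul : forall f, L f -> LL (hcomul (W_P k) f).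

(** The product of the kappa's of the classes of the two pieces of v takes the
    value 1 at v, hence also at w. *)
Lemma sim_slices v w n : sim v w -> (n <= wmax v)%N ->
  sim (slicep 0 n v) (slicep 0 n w) /\
  sim (slicep n (wmax v) v) (slicep n (wmax w) w).
Proof.
move=> vw nv; have := L_inv (L_mul (LL_kappa (slicep 0 n v) (slicep n (wmax v)
  v))) vw.
rewrite !hmul_kappa wmax_slicep (minn_idPl nv) subn0.
case: asboolP => [_|[]]; last by split; exact: sim_refl.
by case: asboolP => // _ /eqP; rewrite oner_eq0.
Qed.

Lemma slicep_min m n w : slicep m n w = slicep m (minn n (wmax w)) w.
Proof. by rewrite -{1}(slicep_all w) slicep_slicep !add0n. Qed.

(** The slice (m, n] is obtained by restricting to letters at most n and then to
    letters greater than m; [sim_slices] treats each of these steps. *)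
Lemma sim_slicep_of_mul m n v w : sim v w -> sim (slicep m n v) (slicep m n w).
Proof.
move=> vw; rewrite slicep_min [slicep m n w]slicep_min -(sim_wmax vw).
set q := minn n (wmax v).
have [mq|qm] := leqP m q; last first.
  rewrite (_ : slicep m q v = slicep m q w); first exact: sim_refl.
  by apply: val_inj; rewrite /= !slice_nil // ltnW.
have [qvw _] : sim (slicep 0 q v) (slicep 0 q w) /\ _ := sim_slices vw
  (geq_minr _ _).
have [] := sim_slices qvw (n := m).
  by rewrite wmax_slicep; lia.
rewrite !wmax_slicep -(sim_wmax vw) !slicep_slicep !add0n.
by rewrite (_ : minn (_ - 0) q = q); last lia.
Qed.

Lemma P_algebraic_of_closed : P_algebraic k sim.
Proof.
split=> [v w v' w' pv pw pv' pw' vv' ww' x _|v w pv pw vw m n]; last first.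
  exact: (@sim_slicep_of_mul m n (Packed pv) (Packed pw)).
apply/natr_eqP/eqP.
(* A class without packed words contains no destandardization at all. *)
have [[z xz]|nz] := pselect (exists z : packed, sim x z).
  have zE (u u' : seq nat) : ndestd sim u u' x = ndestd sim u u' z.
    rewrite /ndestd; congr (#|` fset_set _|%fset); apply/seteqP.
    by split=> y /= [h ?]; split=> //;
      [exact: sim_trans (sim_sym xz) h|exact: sim_trans xz h].
  rewrite !zE -(coprod_kappa z (Packed pv) (Packed pw)) -(coprod_kappa z
    (Packed pv') (Packed pw')).
  rewrite -!hcomulE; have := LL_inv (L_comul (L_kappa z)).
  by move=> /(_ (Packed pv) (Packed pv') (Packed pw) (Packed pw')); exact.
have n0 a b : ndestd sim a b x = 0%N.
  rewrite ndestdE; apply/eqP; rewrite -leqn0 leqNgt -has_count.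
  by apply/hasPn => z _; apply/asboolP => xz; apply: nz; exists z.
by rewrite (n0 (Packed pv) (Packed pw)) (n0 (Packed pv') (Packed pw')).
Qed.

End Necessity.

(** * P-algebraic relations give closed subspaces *)

Section Sufficiency.
Hypothesis alg : P_algebraic k sim.

Lemma sim_slicep m n v w : sim v w -> sim (slicep m n v) (slicep m n w).
Proof. by case: alg => _ H vw; apply: (H v w) => //; exact: valP. Qed.

Lemma invariant2_hcomul f : invariant f -> invariant2 (hcomul (W_P k) f).
Proof.
move=> fi a a' b b' aa' bb'; rewrite !hcomulE.
pose r := undup (map rep (cuts a b ++ cuts a' b')).
have rr : {in r, forall w, rep w = w}.
  by move=> w; rewrite mem_undup => /mapP [z _ ->]; exact: rep_rep.
have sub c c' : {subset cuts c c' <= cuts a b ++ cuts a' b'} ->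
    {subset map rep (cuts c c') <= r}.
  by move=> h w /mapP [z /h hz ->]; rewrite mem_undup map_f.
rewrite !(coprod_invariant fi (undup_uniq _) _ rr).
- apply: eq_bigr => w _; congr (_ * _); apply/eqP/natr_eqP.
  case: alg => H _; apply: H => //; try exact: valP.
  by apply/negP; rewrite (packed_mem (valP w)).
- by apply: sub => z zc; rewrite mem_cat zc orbT.
- by apply: sub => z zc; rewrite mem_cat zc.
Qed.

Lemma invariant_hmul x : invariant2 x -> invariant (hmul (W_P k) x).
Proof.
move=> xi v w vw; rewrite !hmulE -(sim_wmax vw); apply: eq_bigr => m _.
by apply: xi; exact: sim_slicep.
Qed.

Lemma invariant_hunit x : invariant (hunit (W_P k) x).
Proof. by move=> v w vw; rewrite /= /delta -!wmax_eq0 (sim_wmax vw). Qed.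

(** Induction along the recursion for the antipode: both the pieces of w and the
    functions [fun u => coprod f u c] may be replaced by those of a related
    word. *)
Lemma invariant_antipode f : invariant f -> invariant (antipode f).
Proof.
move=> fi v w vw; elim/packed_ind: v w f fi vw => v IH w f fi vw.
have [v0|v0] := eqVneq v packed0.
  by rewrite (_ : w = v) //; apply/eqP;
    rewrite v0 -wmax_eq0 -(sim_wmax vw) wmax_eq0 v0.
have w0 : w != packed0 by rewrite -wmax_eq0 -(sim_wmax vw) wmax_eq0.
rewrite !antipodeE // -(sim_wmax vw); congr (- _).
apply: eq_big_nat => m /andP[_ mv]; have fi2 := invariant2_hcomul fi.
transitivity
  (antipode (fun u => coprod f u (slicep m (wmax v) w)) (slicep 0 m v)).
  apply: antipode_eq => z _; rewrite -!hcomulE.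
  by apply: fi2; [exact: sim_refl|exact: sim_slicep].
apply: IH; [by rewrite wmax_slicep; lia| |exact: sim_slicep].
by move=> u u' uu'; rewrite -!hcomulE; apply: fi2 => //; exact: sim_refl.
Qed.

End Sufficiency.

(** * The two equivalences *)

(** The representatives index a pseudobasis of the space of invariant functions:
    [of_reps], which extends a function on representatives to be constant on
    classes, is a homeomorphism with inverse the restriction. *)
Local Notation reps := {w : packed | rep w == w}.

Definition to_rep w : reps := exist _ (rep w) (introT eqP (rep_rep w)).

Definition of_reps (g : reps -> k) : packed -> k := fun w => g (to_rep w).

Lemma to_repK (j : reps) : to_rep (val j) = j.
Proof. by apply: val_inj; exact/eqP/(valP j). Qed.

Lemma to_rep_eq v w : sim v w -> to_rep v = to_rep w.
Proof. by move=> /rep_eqP vw; apply: val_inj. Qed.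

Lemma of_reps_morphism : lc_morphism of_reps.
Proof.
split=> //; apply: finitary_continuous => w; exists [:: to_rep w] => f g.
by apply; rewrite inE.
Qed.

Lemma of_reps_val f : invariant f -> of_reps (f \o val) = f.
Proof. by move=> fi; apply/funext => w; rewrite /of_reps /= invariant_rep. Qed.

Lemma of_repsK (g : reps -> k) : of_reps g \o val = g.
Proof. by apply/funext => j; rewrite /of_reps /= to_repK. Qed.

Lemma of_reps_invariant (g : reps -> k) : invariant (of_reps g).
Proof. by move=> v w /to_rep_eq vw; rewrite /of_reps vw. Qed.

Lemma of_reps_parametrization : lc_parametrization of_reps invariant.
Proof.
split; first exact: of_reps_morphism.
- by move=> g h gh; rewrite -(of_repsK g) gh of_repsK.
- apply/seteqP; split=> [_ [g _ <-]|f fi]; first exact: of_reps_invariant.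
  by exists (f \o val); rewrite ?of_reps_val.
move=> U oU; exists [set f : packed -> k | U (f \o val)].
  have : lc_continuous (fun f : packed -> k => f \o (val : reps -> packed)).
    apply: finitary_continuous => j; exists [:: val j] => f g fg /=.
    by apply: fg; rewrite inE.
  by move=> /continuousP; apply.
apply/seteqP; split=> [_ [g Ug <-]|f [/= Uf fi]].
  by split; [rewrite /= of_repsK|exact: of_reps_invariant].
by exists (f \o val); rewrite ?of_reps_val.
Qed.

(** The tensor square of [of_reps] extends functions on pairs of representatives
    in the same way. *)
Lemma range_tensor_of_reps : range (tensor_map of_reps of_reps) = invariant2.
Proof.
have mE y a b : tensor_map of_reps of_reps y (a, b) = y (to_rep a, to_rep b).
  by rewrite tensor_mapE //; exact: of_reps_morphism.
apply/seteqP; split=> [_ [y _ <-] a a' b b' aa' bb'|x xi].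
  by rewrite !mE (to_rep_eq aa') (to_rep_eq bb').
exists (fun p => x (val p.1, val p.2)) => //; apply/funext => -[a b].
by rewrite mE /=; apply: xi; apply: sim_sym; exact: sim_rep.
Qed.

Lemma lc_hopf_iff :
  lc_hopf_subalgebra (W_P k) (K_P_hat k sim) <-> P_algebraic k sim.
Proof.
rewrite K_P_hatE; split=> [[J [phi [S [[mphi _ rphi _] _ _ [Hm _ Hc _]]]]]|alg].
  apply: P_algebraic_of_closed Hm Hc => //.
  - have phi_inv (g : J -> k) : invariant (phi g) by rewrite -rphi; exists g.
    move=> _ [y _ <-] a a' b b' aa' bb'; rewrite /tensor_map /lc_extend /lc_sum.
    apply: eq_fsbigr => p _; rewrite /tensor /=.
    by rewrite (phi_inv _ _ _ aa') (phi_inv _ _ _ bb').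
  - exact: kappa_invariant.
  - move=> v w.
    have [g _ gE] : range phi (kappa k (sim_class v)) by rewrite rphi;
      exact: kappa_invariant.
    have [h _ hE] : range phi (kappa k (sim_class w)) by rewrite rphi;
      exact: kappa_invariant.
    exists (tensor g h) => //; apply/funext => -[a b]; rewrite tensor_mapE //.
    rewrite /tensor /= -gE -hE mulrC -(lc_morphism_lin mphi).
    by congr (phi _ a); apply/funext => i; rewrite (lc_morphism_lin mphi) mulrC.
exists reps, of_reps, (@antipode k); split.
- exact: of_reps_parametrization.
- exact: antipode_morphism.
- exact: antipodeP.
rewrite range_tensor_of_reps; split.
- exact: invariant_hmul.
- exact: invariant_hunit.
- exact: invariant2_hcomul.
- exact: invariant_antipode.
Qed.

Lemma invariant_sum n (e : 'I_n -> k) (h : 'I_n -> packed -> k) :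
  (forall t, invariant (h t)) -> invariant (fun w => \sum_(t < n) e t * h t w).
Proof.
by move=> hi v w vw; apply: eq_bigr => t _; rewrite (hi t _ _ vw).
Qed.

Lemma graded_hopf_iff : homogeneous sim ->
  graded_hopf_subalgebra wdeg (W_P k) (K_P k sim) <-> P_algebraic k sim.
Proof.
move=> hom.
have kfin w : Defs.finsupp (kappa k (sim_class w)).
  apply/bounded_size; exists (size w) => v wv; rewrite kappa_asbool.
  by case: asboolP => // /hom; lia.
have K_PE : K_P k sim = [set f | invariant f /\ Defs.finsupp f].
  apply/seteqP; split=> [f [n [h [e [hk ->]]]]|f [fi ff]].
    have hE t : exists w, h t = kappa k (sim_class w).
      by have [E [w EE] <-] := hk t; exists w; rewrite EE.
    split; [apply: invariant_sum|apply: finsupp_lin] => t; have [w ->] := hE t.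
      exact: kappa_invariant.
    exact: kfin.
  apply: (span_retract (r := rep)) ff (invariant_rep fi) => w.
  exists (sim_class w); first by exists w.
  by apply/funext => v; rewrite kappaE.
(* The indicator of a product of two classes is the tensor of their kappa's. *)
have LLE :
    span [set x | exists f g, [/\ K_P k sim f, K_P k sim g & x = tensor f g]] =
    [set x | invariant2 x /\ Defs.finsupp x].
  apply/seteqP; split=> [x [n [h [e [hk ->]]]]|x [xi xf]].
    split; last first.
      apply: finsupp_lin => t; have [f [g [+ + ->]]] := hk t.
      by rewrite K_PE => -[_ ff] [_ fg]; exact: finsupp_tensor.
    move=> a a' b b' aa' bb'; apply: eq_bigr => t _;
      have [f [g [+ + ->]]] := hk t.
    by rewrite K_PE => -[fi _] [gi _];
      rewrite /tensor /= (fi _ _ aa') (gi _ _ bb').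
  apply: (span_retract (r := fun p => (rep p.1, rep p.2))) xf _ =>
    [[a b]|[a b]] /=.
    exists (kappa k (sim_class a)), (kappa k (sim_class b)); rewrite K_PE;
      split.
    - by split; [exact: kappa_invariant|exact: kfin].
    - by split; [exact: kappa_invariant|exact: kfin].
    by apply/funext => -[c d]; rewrite /tensor /= !kappaE -natrM mulnb.
  by apply: xi; apply: sim_sym; exact: sim_rep.
split=> [[S [_ _ _ [Hm _ Hc _]]]|alg].
  apply: P_algebraic_of_closed Hm Hc => [f|x|w|v w]; rewrite ?LLE ?K_PE.
  - by case.
  - by case.
  - by split; [exact: kappa_invariant|exact: kfin].
  - split; last exact: finsupp_tensor.
    move=> a a' b b' aa' bb'; rewrite /tensor /=.
    by rewrite (kappa_invariant _ aa') (kappa_invariant _ bb').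
exists (@antipode k); split.
- rewrite K_PE; split.
  + by move=> f [].
  + by split=> //; apply/bounded_size; exists 0%N.
  + move=> x f g [fi ff] [gi fg]; split.
      by move=> v w vw; rewrite (fi _ _ vw) (gi _ _ vw).
    have /bounded_size [n fn] := ff; have /bounded_size [m gm] := fg.
    apply/bounded_size; exists (maxn n m) => w; rewrite gtn_max => /andP[nw mw].
    by rewrite fn // gm // mulr0 addr0.
  move=> n f [fi ff]; split.
    by move=> v w vw; rewrite /wdeg (hom _ _ vw) (fi _ _ vw).
  have /bounded_size [m fm] := ff.
  by apply/bounded_size; exists m => w mw; rewrite fm ?if_same.
- split; last exact: finsupp_antipode.
  by move=> x f g _ _; apply/funext => w; exact: antipode_lin.
- exact: antipodeP.
rewrite LLE K_PE; split.
- by move=> x [xi xf]; split; [exact: invariant_hmul|exact: finsupp_hmul].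
- move=> x; split; first exact: invariant_hunit.
  apply/bounded_size; exists 0%N => w w0; rewrite /= /delta.
  by rewrite -size_eq0_packed -[_ == 0%N]negbK -lt0n w0 mulr0.
- by move=> f [fi ff]; split; [exact: invariant2_hcomul|exact: finsupp_hcomul].
by move=> f [fi ff]; split; [exact: invariant_antipode|exact: finsupp_antipode].
Qed.
End Classes.

Theorem theorem5p10 (k : fieldType) (sim : seq nat -> seq nat -> Prop) :
  word_relation sim ->
  (lc_hopf_subalgebra (W_P k) (K_P_hat k sim) <-> P_algebraic k sim) /\
  (homogeneous sim ->
   (graded_hopf_subalgebra wdeg (W_P k) (K_P k sim) <-> P_algebraic k sim)).
Proof. by move=> simP; split; [exact: lc_hopf_iff|exact: graded_hopf_iff]. Qed.
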